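(* Let $N\ge3$ and let $\Omega\subset\mathbb{R}^N$ be an open set. Assume $0\le s_1<s_2<s_3\le2$. Then with $\theta=\frac{(N-s_1)(s_3-s_2)}{(N-s_2)(s_3-s_1)}\in(0,1)$ one has $$|u|_{2^*(s_2),s_2}\le|u|_{2^*(s_1),s_1}^{\theta}\,|u|_{2^*(s_3),s_3}^{1-\theta}$$ for all $u\in L^{2^*(s_1)}\big(\Omega,\frac{dx}{|x|^{s_1}}\big)\cap L^{2^*(s_3)}\big(\Omega,\frac{dx}{|x|^{s_3}}\big)$.
   Context: $2^*(s):=\frac{2(N-s)}{N-2}$ and $|u|_{p,s}:=\big(\int_\Omega|u|^p\frac{dx}{|x|^s}\big)^{1/p}$. *)

(* Defs.v *)
From HB Require Import structures.
From mathcomp Require Import all_boot all_order all_algebra.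
From mathcomp Require Import all_classical all_reals all_analysis.

Set Implicit Arguments.
Unset Strict Implicit.
Unset Printing Implicit Defensive.

Import Order.TTheory GRing.Theory Num.Theory.
Import numFieldNormedType.Exports.

Local Open Scope classical_set_scope.
Local Open Scope ring_scope.

Definition rV_display : measure_display.
Proof. exact. Qed.

Definition rV_coord (R : realType) (n : nat) (i : 'I_n) (x : 'rV[R]_n) : R :=
  x ord0 i.

(* The product sigma-algebra on R^n, generated by the coordinate functions
   (for every n this is the Borel sigma-algebra of the topology on 'rV[R]_n). *)
Section rV_measurable.
Variables (R : realType) (n : nat).

Let rV_set0 : g_sigma_preimage (@rV_coord R n) set0.
Proof. exact: sigma_algebra0. Qed.

Let rV_setC A : g_sigma_preimage (@rV_coord R n) A ->
  g_sigma_preimage (@rV_coord R n) (~` A).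
Proof. exact: sigma_algebraC. Qed.

Let rV_bigcup (F : (set 'rV[R]_n)^nat) :
  (forall i, g_sigma_preimage (@rV_coord R n) (F i)) ->
  g_sigma_preimage (@rV_coord R n) (\bigcup_i (F i)).
Proof. exact: sigma_algebra_bigcup. Qed.

HB.instance Definition _ := @isMeasurable.Build rV_display
  'rV[R]_n (g_sigma_preimage (@rV_coord R n)) rV_set0 rV_setC rV_bigcup.

End rV_measurable.

Lemma measurable_fun_rVP d (T : measurableType d) (R : realType) (n : nat)
    (f : T -> 'rV[R]_n) :
  (forall i, measurable_fun [set: T] (@rV_coord R n i \o f)) ->
  measurable_fun [set: T] f.
Proof.
move=> mf _ A mA; rewrite setTI.
have : preimage_set_system [set: T] f (g_sigma_preimage (@rV_coord R n))
    (f @^-1` A) by exists A => //; rewrite setTI.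
rewrite -g_sigma_preimage_comp; apply: smallest_sub.
  exact: sigma_algebra_measurable.
case: n f mf {mA A} => [|n] f mf; first by rewrite big_ord0.
rewrite -bigcup_mkord_ord; apply: bigcup_sub => i Ii.
by move=> A [B mB <-]; exact: mf.
Qed.

Lemma measurable_rV_coord (R : realType) (n : nat) (i : 'I_n) :
  measurable_fun [set: 'rV[R]_n] (@rV_coord R n i).
Proof.
move=> _ Y mY; rewrite setTI; apply: sub_sigma_algebra => /=.
rewrite -bigcup_seq/=; exists i => /=; first by rewrite mem_index_enum.
by exists Y => //; rewrite setTI.
Qed.

Definition rV_cons (R : realType) (n : nat) (x : R * 'rV[R]_n) : 'rV[R]_n.+1 :=
  row_mx (x.1)%:M x.2.

Lemma measurable_rV_cons (R : realType) (n : nat) :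
  measurable_fun [set: measurableTypeR R * 'rV[R]_n] (@rV_cons R n).
Proof.
apply: measurable_fun_rVP => i.
case: (@split_ordP 1 n i) => j ->.
  rewrite (_ : _ \o _ = fst); first exact: measurable_fst.
  apply/funext => x; rewrite /rV_coord /rV_cons /=.
  by rewrite (row_mxEl (x.1)%:M x.2 ord0 j) (ord1 j) mxE mulr1n.
rewrite (_ : _ \o _ = @rV_coord R n j \o snd).
  exact: measurableT_comp (measurable_rV_coord j) measurable_snd.
by apply/funext => x; exact: (row_mxEr (x.1)%:M x.2 ord0 j).
Qed.

Section borel_lebesgue_succ.
Variables (R : realType) (n : nat) (mu : {measure set 'rV[R]_n -> \bar R}).

Definition borel_lebesgue_succ : set 'rV[R]_n.+1 -> \bar R :=
  pushforward (product_measure2 (@lebesgue_measure R) mu) (@rV_cons R n).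

HB.instance Definition _ := Measure.copy borel_lebesgue_succ
  (measure_function_pushforward__canonical__measure_function_Measure
    (product_measure2 (@lebesgue_measure R) mu) (@measurable_rV_cons R n)).

End borel_lebesgue_succ.

(* Lebesgue measure on the Borel sets of R^n, by R^(n+1) = R x R^n. *)
Fixpoint borel_lebesgue (R : realType) (n : nat) :
    {measure set 'rV[R]_n -> \bar R} :=
  match n with
  | 0 => \d_(0 : 'rV[R]_0)
  | m.+1 => borel_lebesgue_succ (borel_lebesgue R m)
  end.

Lemma borel_lebesgue_box (R : realType) (n : nat) (A : 'I_n -> set (measurableTypeR R)) :
  (forall i, measurable (A i)) ->
  borel_lebesgue R n [set x | forall i, A i (x ord0 i)] =
  (\prod_(i < n) lebesgue_measure (A i))%E.
Proof.
elim: n A => [|n IH] A mA.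
  by rewrite big_ord0 /= diracE mem_set// => -[].
rewrite big_ord_recl -(IH (fun i => A (lift ord0 i)))//.
have mB : measurable [set x : 'rV[R]_n | forall i, A (lift ord0 i) (x ord0 i)].
  have -> : [set x : 'rV[R]_n | forall i, A (lift ord0 i) (x ord0 i)] =
      \big[setI/setT]_(i < n) ((@rV_coord R n i) @^-1` (A (lift ord0 i))).
    rewrite -bigcap_seq; apply/seteqP; split => [x Ax i _|x Ax i]; first exact: Ax.
    by apply: (Ax i); rewrite /= mem_index_enum.
  apply: bigsetI_measurable => i _; rewrite -[X in measurable X]setTI.
  by apply: (@measurable_rV_coord R n i) => //; exact: mA.
rewrite /= /borel_lebesgue_succ /pushforward -product_measure2E//.
congr (product_measure2 _ _ _); apply/seteqP.
have e0 (x : R * 'rV[R]_n) : rV_cons x ord0 ord0 = x.1.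
  have E : lshift n (ord0 : 'I_1) = (ord0 : 'I_n.+1) by exact: val_inj.
  have := row_mxEl (x.1)%:M x.2 ord0 (ord0 : 'I_1).
  by rewrite E [in X in _ = X -> _]mxE eqxx mulr1n.
have eS (x : R * 'rV[R]_n) i : rV_cons x ord0 (lift ord0 i) = x.2 ord0 i.
  have E : rshift 1 i = (lift ord0 i : 'I_n.+1) by exact: val_inj.
  by have := row_mxEr (x.1)%:M x.2 ord0 i; rewrite E.
split => [x Ax|x [A0 AS] i].
  split; first by have := Ax ord0; rewrite e0.
  by move=> i; have := Ax (lift ord0 i); rewrite eS.
by case: (unliftP ord0 i) => [j|] ->; rewrite ?e0 ?eS //; exact: AS.
Qed.

(* The completed (Lebesgue) sigma-algebra of R^n and Lebesgue measure on it;
   [lebesgue_rV R n] is convertible to ['rV[R]_n]. *)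
Definition lebesgue_rV (R : realType) (n : nat) :=
  caratheodory_type (mu_ext (borel_lebesgue R n)).

HB.instance Definition _ (R : realType) (n : nat) :=
  Measurable.on (lebesgue_rV R n).

Definition lebesgue_measure_rV (R : realType) (n : nat) :
    set (lebesgue_rV R n) -> \bar R :=
  @completed_measure_extension _ _ _ (borel_lebesgue R n).

HB.instance Definition _ (R : realType) (n : nat) :=
  Measure.on (@lebesgue_measure_rV R n).

Lemma lebesgue_measure_rVE (R : realType) (n : nat) (A : set 'rV[R]_n) : measurable A ->
  measurable (A : set (lebesgue_rV R n)) /\ lebesgue_measure_rV A = borel_lebesgue R n A.
Proof.
move=> mA; split.
  by apply: sub_caratheodory; apply: sub_sigma_algebra.
by rewrite /lebesgue_measure_rV /completed_measure_extension measurable_mu_extE.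
Qed.

(* The library norm [`|x|] on row vectors is the sup norm. *)
Definition eucl_norm (R : realType) (n : nat) (x : 'rV[R]_n) : R :=
  Num.sqrt (\sum_(i < n) x ord0 i ^+ 2).

Definition crit_exp (R : realType) (N : nat) (s : R) : R :=
  2 * (N%:R - s) / (N%:R - 2).

(* |u|_{p,s}, as an extended real; only the values of [u] on [Omega] matter.
   Since [0^-1 = 0] and [0 `^ 0 = 1], the weight |x|^-s is finite at the origin
   too; this is harmless, the origin being a null set. *)
Definition wnorm (R : realType) (N : nat) (Omega : set 'rV[R]_N) (p s : R)
    (u : 'rV[R]_N -> R) : \bar R :=
  ((\int[@lebesgue_measure_rV R N]_(x in Omega)
     (`|u x| `^ p / eucl_norm x `^ s)%:E) `^ p^-1)%E.

(* L^p(Omega, dx / |x|^s), for representatives. *)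
Definition wLp (R : realType) (N : nat) (Omega : set 'rV[R]_N) (p s : R) :
    set ('rV[R]_N -> R) :=
  [set u | measurable_fun (Omega : set (lebesgue_rV R N)) u /\
           (wnorm Omega p s u < +oo)%E].

(* Main.v *)
Require Import Defs.
From mathcomp Require Import all_boot all_order all_algebra.
From mathcomp Require Import all_classical all_reals all_analysis.
From mathcomp Require Import measurable_realfun.
From mathcomp Require Import ring lra.

Import Order.TTheory GRing.Theory Num.Theory.
Import numFieldNormedType.Exports.

Local Open Scope classical_set_scope.
Local Open Scope ring_scope.

(** The weights interpolate linearly in [s]: with
    [t = (s3 - s2) / (s3 - s1)], the weight exponent [s2] is the barycentre
    [t s1 + (1 - t) s3], and since the critical exponent [2^*(s)] is affine in
    [s], also [2^*(s2) = t 2^*(s1) + (1 - t) 2^*(s3)]. Hence the integrand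
    [|u|^2^*(s2) / |x|^s2] is the product of the powers [t] and [1 - t] of the
    integrands for [s1] and [s3] ([weighted_power_interpolation]), and
    Hoelder's inequality with exponents [1 / t] and [1 / (1 - t)]
    ([hoelder_interpolation]) bounds its integral. Taking the root of order
    [2^*(s2)] turns [t] into [theta = t 2^*(s1) / 2^*(s2)] and [1 - t] into
    [1 - theta = (1 - t) 2^*(s3) / 2^*(s2)].

    Hoelder's inequality requires measurable integrands on a measurable domain.
    The sigma-algebra of [R^n] is generated by the coordinates, so an open set
    is shown to be measurable by writing it as a countable union of boxes with
    rational corners ([open_measurable_rV]). *)

Lemma rat_itv_nbhs (R : realType) (x : R) (P : set R) : nbhs x P ->
  exists q : rat * rat, (x \in `]ratr q.1, ratr q.2[) /\
    [set` `]ratr q.1, ratr q.2[] `<=` P.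
Proof.
move=> /nbhs_ballP[e /= e0 xeP].
have [a] : exists q, ratr q \in `]x - e, x[ by apply: rat_in_itvoo; lra.
have [b] : exists q, ratr q \in `]x, x + e[ by apply: rat_in_itvoo; lra.
rewrite !in_itv/= => /andP[xb be] /andP[ea ax].
exists (a, b); split => /=; first by rewrite in_itv/= ax xb.
move=> y /=; rewrite in_itv/= => /andP[ay yb]; apply: xeP.
by rewrite /ball/= ltr_distlC; apply/andP; split; lra.
Qed.

(** Indexing the boxes by pairs of rationals makes the family countable. *)
Definition rat_box (R : realType) (n : nat) (q : {ffun 'I_n -> rat * rat}) :
    set 'rV[R]_n :=
  [set x | forall i, x ord0 i \in `]ratr (q i).1, ratr (q i).2[].

Lemma measurable_rat_box (R : realType) (n : nat)
  (q : {ffun 'I_n -> rat * rat}) : measurable (rat_box R n q).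
Proof.
have -> : rat_box R n q = \big[setI/setT]_(i < n)
    (@rV_coord R n i @^-1` [set` `]ratr (q i).1, ratr (q i).2[]).
  rewrite -bigcap_seq; apply/seteqP; split => [x qx i _|x qx i]; first exact: qx.
  by apply: (qx i); rewrite /= mem_index_enum.
apply: bigsetI_measurable => i _; rewrite -[X in measurable X]setTI.
exact: (measurable_rV_coord i).
Qed.

(** Around each of its points an open set contains a product of neighbourhoods
    of the coordinates, hence a rational box; there are countably many boxes. *)
Lemma open_measurable_rV (R : realType) (n : nat) (A : set 'rV[R]_n) :
  open A -> measurable A.
Proof.
move=> oA.
pose F (q : {ffun 'I_n -> rat * rat}) :=
  if `[< rat_box R n q `<=` A >] then rat_box R n q else set0.
have -> : A = \bigcup_q F q.
  apply/seteqP; split => [x Ax|x [q _]]; last first.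
    by rewrite /F; case: asboolP => // + qx; exact.
  have [P xP PA] : nbhs x A by exact: open_nbhs_nbhs.
  have [q qP] := choice (fun i => rat_itv_nbhs _ _ _ (xP ord0 i)).
  exists [ffun i => q i] => //; rewrite /F asboolT.
    by move=> i; rewrite ffunE; exact: (qP i).1.
  move=> y qy; apply: PA => i j; rewrite (ord1 i); apply: (qP j).2.
  by have := qy j; rewrite ffunE.
apply: countable_bigcupT_measurable => // q; rewrite /F.
by case: ifPn => // _; exact: measurable_rat_box.
Qed.

(** The completed sigma-algebra is finer than the one generated by the
    coordinates, so measurability transfers to it. *)
Lemma measurable_fun_lebesgue_rV d (T : measurableType d) (R : realType)
    (n : nat) (D : set (lebesgue_rV R n)) (f : 'rV[R]_n -> T) :
  measurable_fun [set: 'rV[R]_n] f ->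
  measurable_fun D (f : lebesgue_rV R n -> T).
Proof.
move=> mf; apply: measurable_funTS => _ Y mY.
by apply: (lebesgue_measure_rVE _).1; exact: mf.
Qed.

Lemma measurable_funpowR d (T : measurableType d) (R : realType)
    (D : set T) (f : T -> R) (p : R) :
  measurable_fun D f -> measurable_fun D (fun x => f x `^ p).
Proof. exact: measurableT_comp (measurable_powR _). Qed.

Lemma eucl_norm_ge0 (R : realType) (n : nat) (x : 'rV[R]_n) :
  0 <= eucl_norm x.
Proof. exact: sqrtr_ge0. Qed.

Lemma measurable_eucl_norm (R : realType) (n : nat) :
  measurable_fun [set: 'rV[R]_n] (@eucl_norm R n).
Proof.
(* the square root is the power [2^-1], covered by measurability of powers *)
rewrite (_ : @eucl_norm R n =
    (fun y => y `^ 2^-1) \o (fun x : 'rV[R]_n => \sum_(i < n) x ord0 i ^+ 2)).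
  apply: measurableT_comp; first exact: measurable_powR.
  apply: measurable_sum => i; apply: measurable_funX.
  exact: measurable_rV_coord.
by apply/funext => x /=; rewrite powR12_sqrt// sumr_ge0// => i _; exact: sqr_ge0.
Qed.

(** Hoelder's inequality for [f^t] and [g^(1-t)] with conjugate exponents
    [1 / t] and [1 / (1 - t)], which turn these powers back into [f] and [g].
    In this form the right-hand side is a product of plain integrals, the shape
    needed to interpolate weighted norms. *)
Lemma hoelder_interpolation d (T : measurableType d) (R : realType)
    (mu : {measure set T -> \bar R}) (D : set T) (f g : T -> R) (t : R) :
  measurable D -> measurable_fun D f -> measurable_fun D g ->
  (forall x, 0 <= f x) -> (forall x, 0 <= g x) -> 0 < t < 1 ->
  (\int[mu]_(x in D) (f x `^ t * g x `^ (1 - t))%:E <=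
   (\int[mu]_(x in D) (f x)%:E) `^ t *
   (\int[mu]_(x in D) (g x)%:E) `^ (1 - t))%E.
Proof.
move=> mD mf mg f0 g0 /andP[t0 t1].
have t1' : 0 < 1 - t by rewrite subr_gt0.
(* the restrictions to [D] are extended by zero, to use whole-space norms *)
have mr (h : T -> R) s : measurable_fun D h ->
    measurable_fun setT ((fun x => h x `^ s) \_ D).
  move=> mh; apply/(measurable_restrictT _ mD).
  exact: measurable_funpowR.
have LnormE (h : T -> R) s : (forall x, 0 <= h x) -> 0 < s ->
    Lnorm mu (s^-1)%:E (EFin \o (fun x => h x `^ s) \_ D) =
    ((\int[mu]_(x in D) (h x)%:E) `^ s)%E.
  move=> h0 s0; rewrite unlock invrK [in RHS]integral_mkcond.
  congr (_ `^ _)%E; apply: eq_integral => x _.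
  rewrite /= !patchE; case: ifPn => _ /=.
    by rewrite ger0_norm ?powR_ge0// -powRrM divff ?gt_eqF// powRr1.
  by rewrite normr0 powR0// invr_eq0 gt_eqF.
have := @hoelder _ _ _ mu _ _ t^-1 (1 - t)^-1 (mr f t mf) (mr g (1 - t) mg).
rewrite !invr_gt0 !invrK subrKC !LnormE// => /(_ t0 t1' erefl).
apply: le_trans; rewrite Lnorm1 integral_mkcond le_eqVlt; apply/orP; left.
apply/eqP; apply: eq_integral => x _; rewrite /= !patchE.
case: ifPn => _ /=; last by rewrite mul0r normr0.
by rewrite ger0_norm// mulr_ge0 ?powR_ge0.
Qed.

(** The laws of exponents, except at [r = 0], where [0 `^ 0 = 1] and
    [0^-1 = 0]: there [s2 != 0] makes the left-hand side vanish, and also forces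
    [s1 * t != 0] or [s3 * (1 - t) != 0], so one of the two factors on the
    right vanishes. *)
Lemma weighted_power_interpolation (R : realType) (a r p1 p2 p3 s1 s2 s3 t : R) :
  p2 != 0 -> s2 != 0 ->
  p2 = p1 * t + p3 * (1 - t) -> s2 = s1 * t + s3 * (1 - t) -> 0 <= r ->
  a `^ p2 / r `^ s2 =
  (a `^ p1 / r `^ s1) `^ t * (a `^ p3 / r `^ s3) `^ (1 - t).
Proof.
move=> p2N0 s2N0 p2E s2E r0.
have [->|rN0] := eqVneq r 0.
  have vanish s e : s * e != 0 -> forall p, (a `^ p / 0 `^ s) `^ e = 0.
    rewrite mulf_eq0 negb_or => /andP[sN0 eN0] p.
    by rewrite [0 `^ s]powR0// invr0 mulr0 powR0.
  rewrite [0 `^ s2]powR0// invr0 mulr0.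
  have [s1t0|s1tN0] := eqVneq (s1 * t) 0; last by rewrite vanish ?mul0r.
  by rewrite [X in _ * X]vanish ?mulr0//; move: s2N0; rewrite s2E s1t0 add0r.
rewrite -!powRN !powRM ?powR_ge0// -!powRrM mulrACA.
rewrite -(@powRD _ a) -?p2E ?(negPf p2N0)// -powRD ?rN0 ?implybT//.
by rewrite !mulNr -opprD -s2E.
Qed.

Definition weighted_integral (R : realType) (N : nat)
    (Omega : set (lebesgue_rV R N)) (p s : R) (u : lebesgue_rV R N -> R) :
    \bar R :=
  (\int[@lebesgue_measure_rV R N]_(x in Omega)
    (`|u x| `^ p / eucl_norm x `^ s)%:E)%E.
Arguments weighted_integral {R N}.

Lemma weighted_integral_interpolation (R : realType) (N : nat)
    (Omega : set (lebesgue_rV R N)) (u : lebesgue_rV R N -> R)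
    (p1 p2 p3 s1 s2 s3 t : R) :
  measurable Omega -> measurable_fun Omega u -> 0 < t < 1 ->
  p2 != 0 -> s2 != 0 ->
  p2 = p1 * t + p3 * (1 - t) -> s2 = s1 * t + s3 * (1 - t) ->
  (weighted_integral Omega p2 s2 u <=
   weighted_integral Omega p1 s1 u `^ t *
   weighted_integral Omega p3 s3 u `^ (1 - t))%E.
Proof.
move=> mOmega mu t01 p2N0 s2N0 p2E s2E.
pose h p s (x : lebesgue_rV R N) := `|u x| `^ p / eucl_norm x `^ s.
have h0 p s x : 0 <= h p s x by rewrite divr_ge0 ?powR_ge0.
have mh p s : measurable_fun Omega (h p s).
  (* a negative power replaces the division, so powers are the only case *)
  rewrite (_ : h p s = (fun x => `|u x| `^ p * eucl_norm x `^ (- s))).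
    apply: measurable_funM; apply: measurable_funpowR.
      exact: (measurableT_comp _ mu).
    by apply: measurable_fun_lebesgue_rV; exact: measurable_eucl_norm.
  by apply/funext => x; rewrite powRN.
have := hoelder_interpolation _ _ _ (@lebesgue_measure_rV R N)
  _ _ _ _ mOmega (mh p1 s1) (mh p3 s3) (h0 _ _) (h0 _ _) t01.
apply: le_trans; rewrite le_eqVlt; apply/orP; left; apply/eqP.
apply: eq_integral => x _; congr (_%:E).
by apply: weighted_power_interpolation => //; exact: eucl_norm_ge0.
Qed.

(** Extraction of roots in an interpolation inequality: the exponents are
    rescaled by the ratio of the orders of the roots. *)
Lemma poweR_root_interpolation (R : realType) (x1 x2 x3 : \bar R)
    (p1 p2 p3 t1 t3 r1 r3 : R) :
  (0 <= x2)%E -> 0 <= p2 -> (x2 <= x1 `^ t1 * x3 `^ t3)%E ->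
  t1 / p2 = p1^-1 * r1 -> t3 / p2 = p3^-1 * r3 ->
  (x2 `^ p2^-1 <= (x1 `^ p1^-1) `^ r1 * (x3 `^ p3^-1) `^ r3)%E.
Proof.
move=> x2_ge0 p2_ge0 x2le r1E r3E.
rewrite -!(poweRrM _ _ r1) -!(poweRrM _ _ r3) -r1E -r3E !poweRrM.
rewrite -poweRM ?poweR_ge0//.
apply: gt0_ler_poweR x2le; rewrite ?invr_ge0// in_itv/= leey andbT//.
by rewrite mule_ge0 ?poweR_ge0.
Qed.

Theorem proposition1 (R : realType) (N : nat) (Omega : set 'rV[R]_N)
    (s1 s2 s3 : R) (hN : (3 <= N)%N) (hOmega : open Omega)
    (hs1 : 0 <= s1) (hs12 : s1 < s2) (hs23 : s2 < s3) (hs3 : s3 <= 2) :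
  let theta := (N%:R - s1) * (s3 - s2) / ((N%:R - s2) * (s3 - s1)) in
  0 < theta < 1 /\
  forall u : 'rV[R]_N -> R,
    u \in wLp Omega (crit_exp N s1) s1 `&` wLp Omega (crit_exp N s3) s3 ->
    (wnorm Omega (crit_exp N s2) s2 u <=
     wnorm Omega (crit_exp N s1) s1 u `^ theta *
     wnorm Omega (crit_exp N s3) s3 u `^ (1 - theta))%E.
Proof.
move=> theta.
have N3 : 3 <= N%:R :> R by rewrite ler_nat.
split.
  rewrite /theta; apply/andP; split.
    by rewrite divr_gt0// mulr_gt0//; lra.
  rewrite ltr_pdivrMr ?mul1r; last by rewrite mulr_gt0//; lra.
  rewrite -subr_gt0.
  have -> : (N%:R - s2) * (s3 - s1) - (N%:R - s1) * (s3 - s2) =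
    (N%:R - s3) * (s2 - s1) by ring.
  by rewrite mulr_gt0//; lra.
move=> u; rewrite inE => -[[mu _] _].
pose t := (s3 - s2) / (s3 - s1).
have t01 : 0 < t < 1.
  by rewrite divr_gt0 ?ltr_pdivrMr ?mul1r/=; lra.
have s2E : s2 = s1 * t + s3 * (1 - t) by rewrite /t; field; lra.
have pE : crit_exp N s2 = crit_exp N s1 * t + crit_exp N s3 * (1 - t).
  by rewrite /crit_exp {1}s2E; field; lra.
have p2_gt0 : 0 < crit_exp N s2.
  by rewrite /crit_exp divr_gt0 ?mulr_gt0//; lra.
have mOmega : measurable (Omega : set (lebesgue_rV R N)).
  by have [] := lebesgue_measure_rVE (open_measurable_rV _ _ _ hOmega).
apply: (@poweR_root_interpolation _ _ _ _ _ _ _ t (1 - t)).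
- by apply: integral_ge0 => x _; rewrite lee_fin divr_ge0 ?powR_ge0.
- exact: ltW.
- apply: weighted_integral_interpolation => //; first by rewrite gt_eqF.
  by rewrite gt_eqF//; lra.
- rewrite /t /theta /crit_exp; field.
  by repeat (apply/andP; split); lra.
- rewrite /t /theta /crit_exp; field.
  by repeat (apply/andP; split); lra.
Qed.
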